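(* Let $G$ be an $(X,Y)$-bipartite graph with $|X|=m$ and $|Y|=n$. If $\delta(X,Y) > \frac{2}{3} n$ and $\delta(Y,X) > \frac{2}{3} m$, then in every 2-edge coloring of $G$ there exists a monochromatic component on at least $\frac{m+n}{2}$ vertices.
   Context: For an $(X,Y)$-bipartite graph $G$, $\delta(X,Y)$ denotes the minimum degree of a vertex of $X$ (into $Y$), and $\delta(Y,X)$ the minimum degree of a vertex of $Y$ (into $X$). In an edge-colored graph, a monochromatic component is a connected component of the subgraph formed by the edges of a single color. *)

(* Defs.v *)
From mathcomp Require Import all_boot all_order all_algebra.

Set Implicit Arguments.
Unset Strict Implicit.
Unset Printing Implicit Defensive.

Definition simple_graph (T : finType) (e : rel T) : Prop :=
  symmetric e /\ irreflexive e.

Definition bipartition (T : finType) (e : rel T) (X Y : {set T}) : Prop :=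
  [/\ X :|: Y = [set: T],
      [disjoint X & Y] &
      forall u v, e u v ->
        (u \in X) && (v \in Y) || (u \in Y) && (v \in X)].

Definition degree_in (T : finType) (e : rel T) (B : {set T}) (x : T) : nat :=
  #|[set y in B | e x y]|.

(* Every degree into B is at most #|B|, so the neutral element #|B| only
   matters when A is empty. *)
Definition min_degree (T : finType) (e : rel T) (A B : {set T}) : nat :=
  \big[minn/#|B|]_(x in A) degree_in e B x.

(* A coloring assigns a color to the unordered pair [set u; v]; its values on
   sets that are not edges are never used. *)
Definition color_rel (T : finType) (e : rel T) (k : nat)
    (c : {set T} -> 'I_k) (i : 'I_k) : rel T :=
  [rel u v | e u v && (c [set u; v] == i)].

Definition color_support (T : finType) (e : rel T) (k : nat)
    (c : {set T} -> 'I_k) (i : 'I_k) : {set T} :=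
  [set u | [exists v, color_rel e c i u v]].

(* The subgraph formed by the edges of color i has as vertices only the
   endpoints of those edges, so isolated vertices are not components. *)
Definition mono_components (T : finType) (e : rel T) (k : nat)
    (c : {set T} -> 'I_k) (i : 'I_k) : {set {set T}} :=
  equivalence_partition (connect (color_rel e c i)) (color_support e c i).

(* Main.v *)
Require Import Defs.
From mathcomp Require Import all_boot all_order all_algebra zify lra.

Import Order.TTheory GRing.Theory Num.Theory.
Local Open Scope ring_scope.

(** Label every vertex by its pair (red component, blue component), a cell of
    a grid whose rows are the red and whose columns are the blue components.
    Adjacent vertices share a row or a column, so the cross through a vertex
    of one side contains more than two thirds of the other side.  Three vertices
    of one side in general position would have a common neighbour, which would
    share a line with two of them; hence no such triple exists, and each side
    is covered by two lines (König).  If two lines cover both sides, one of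
    them has at least half of the vertices; the other configurations are
    excluded, or give one large line, by counting crosses. *)

(** * Lines and crosses in the grid of two labelings *)

Section TwoLabelings.
Set Implicit Arguments.
Unset Strict Implicit.
Local Open Scope nat_scope.

Definition cnt (T : finType) (A : {set T}) (P : pred T) : nat :=
  #|[set x in A | P x]|.

Definition same_line (T I J : eqType) (r : T -> I) (b : T -> J) : rel T :=
  fun x y => (r y == r x) || (b y == b x).

Definition dense_crosses (T : finType) (I J : eqType) (A B : {set T})
    (r : T -> I) (b : T -> J) : Prop :=
  forall x, x \in A -> (2 * #|B| < 3 * cnt B (same_line r b x)).

(** The negation of the desired conclusion for one color, assumed towards a contradiction. *)
Definition small_lines (T : finType) (I : eqType) (A B : {set T})
    (f : T -> I) : Prop :=
  forall i, (2 * (cnt A (fun x => f x == i) + cnt B (fun x => f x == i))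
             < #|A| + #|B|).

Definition general_position (T I J : eqType) (r : T -> I) (b : T -> J)
    (x y z : T) : bool :=
  uniq [:: r x; r y; r z] && uniq [:: b x; b y; b z].

Lemma cntE (T : finType) (A : {set T}) (P : pred T) :
  cnt A P = \sum_(x in A) P x.
Proof.
rewrite /cnt -sum1_card [LHS](eq_bigl (fun x => (x \in A) && P x)); last first.
  by move=> x; rewrite inE.
by rewrite big_mkcondr; apply: eq_bigr => x _; case: (P x).
Qed.

Lemma cnt_predC (T : finType) (A : {set T}) (P : pred T) :
  cnt A P + cnt A (predC P) = #|A|.
Proof.
by rewrite !cntE -big_split -sum1_card; apply: eq_bigr => x _ /=; case: (P x).
Qed.

Lemma leq_cnt (T : finType) (A : {set T}) (P Q : pred T) :
  {in A, forall x, P x -> Q x} -> cnt A P <= cnt A Q.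
Proof.
move=> PQ; rewrite !cntE; apply: leq_sum => x /PQ.
by case: (P x) => // ->.
Qed.

Lemma leq_cnt_cover (T : finType) (A : {set T}) (P Q : pred T) :
  {in A, forall x, P x || Q x} -> #|A| <= cnt A P + cnt A Q.
Proof.
move=> PQ; rewrite -(cnt_predC A P) leq_add2l; apply: leq_cnt => x /PQ /=.
by case: (P x).
Qed.

Lemma leq_cnt_disjoint (T : finType) (A : {set T}) (P Q : pred T) :
  {in A, forall x, P x -> ~~ Q x} -> cnt A P + cnt A Q <= #|A|.
Proof.
move=> PQ; rewrite -(cnt_predC A Q) addnC leq_add2l; exact: leq_cnt.
Qed.

Lemma cntID (T : finType) (A : {set T}) (P Q : pred T) :
  cnt A P = cnt A (predI P Q) + cnt A (predI P (predC Q)).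
Proof.
rewrite !cntE -big_split; apply: eq_bigr => x _ /=.
by case: (P x); case: (Q x).
Qed.

Lemma same_lineC (T I J : eqType) (r : T -> I) (b : T -> J) x y :
  same_line b r x y = same_line r b x y.
Proof. exact: orbC. Qed.

Lemma dense_crossesC (T : finType) (I J : eqType) (A B : {set T})
    (r : T -> I) (b : T -> J) :
  dense_crosses A B r b -> dense_crosses A B b r.
Proof.
move=> D x /D; congr (_ < 3 * _); rewrite !cntE.
by apply: eq_bigr => y _; rewrite same_lineC.
Qed.

Lemma small_linesC (T : finType) (I : eqType) (A B : {set T}) (f : T -> I) :
  small_lines A B f -> small_lines B A f.
Proof. by move=> S i; have := S i; lia. Qed.

(** * Covers of one side by two lines *)

Lemma exists_not_covered (T : finType) (A : {set T}) (P : pred T) :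
  ~ {in A, forall x, P x} -> exists2 x, x \in A & ~~ P x.
Proof.
move=> nP; case: (boolP [exists x in A, ~~ P x]) => [/exists_inP //|].
move/exists_inPn=> h; case: nP => x /h; exact: negbNE.
Qed.

(** Each [w] in [B] lies in at most one of three distinct rows and one of three distinct columns,
    hence in at most two of the three crosses; but the crosses have total size above [2 * #|B|]. *)
Lemma no_general_position (T : finType) (I J : eqType) (A B : {set T})
    (r : T -> I) (b : T -> J) :
  dense_crosses A B r b ->
  {in A & A & A, forall x y z, ~~ general_position r b x y z}.
Proof.
move=> D x y z xA yA zA; apply/negP => /andP[].
rewrite /= !inE !negb_or !andbT => /andP[/andP[rxy rxz] ryz].
move=> /andP[/andP[bxy bxz] byz].
suff: cnt B (same_line r b x) + cnt B (same_line r b y)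
      + cnt B (same_line r b z) <= 2 * #|B|.
  by move: (D _ xA) (D _ yA) (D _ zA); lia.
rewrite !cntE -!big_split /= -sum1_card big_distrr /=.
apply: leq_sum => w _; rewrite /same_line.
have rd : (r w == r x) + (r w == r y) + (r w == r z) <= 1.
  case: (eqVneq (r w) (r x)) => [->|_].
    by rewrite (negPf rxy) (negPf rxz).
  by case: (eqVneq (r w) (r y)) => [->|_]; rewrite ?(negPf ryz) //; case: eqP.
have bd : (b w == b x) + (b w == b y) + (b w == b z) <= 1.
  case: (eqVneq (b w) (b x)) => [->|_].
    by rewrite (negPf bxy) (negPf bxz).
  by case: (eqVneq (b w) (b y)) => [->|_]; rewrite ?(negPf byz) //; case: eqP.
by move: rd bd; do 6!case: (_ == _).
Qed.

(** König's theorem for matching number at most 2, with rows and columns as vertices and occupied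
    cells as edges. *)
Lemma two_line_cover (T : finType) (I J : eqType) (A : {set T})
    (r : T -> I) (b : T -> J) : A != set0 ->
  {in A & A & A, forall x y z, ~~ general_position r b x y z} ->
  [\/ exists u v, {in A, forall x, (r x == u) || (r x == v)},
      exists u v, {in A, forall x, (b x == u) || (b x == v)}
    | exists u v, {in A, forall x, (r x == u) || (b x == v)}].
Proof.
move=> /set0Pn[x0 x0A] gp.
have G p q s : p \in A -> q \in A -> s \in A ->
  r p != r q -> r p != r s -> r q != r s ->
  b p != b q -> b p != b s -> b q != b s -> False.
  move=> pA qA sA rpq rps rqs bpq bps bqs; have := gp _ _ _ pA qA sA.
  by rewrite /general_position /= !inE !negb_or rpq rps rqs bpq bps bqs.
case: (boolP [forall x in A, (r x == r x0) || (b x == b x0)]).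
  by move/forall_inP=> h; apply: Or33; exists (r x0), (b x0).
move/forall_inPn=> [x1 x1A]; rewrite negb_or => /andP[r10 b10].
case: (boolP [forall x in A, (r x == r x0) || (r x == r x1)]).
  by move/forall_inP=> h; apply: Or31; exists (r x0), (r x1).
move/forall_inPn=> [x xA]; rewrite negb_or => /andP[rx0 rx1].
(* The point [x] lies in a third row, so it must share a column with [x0] or [x1], whose roles are
   symmetric. *)
wlog bx : x0 x1 x0A x1A r10 b10 rx0 rx1 / b x = b x0.
  move=> W; have [e|nb0] := eqVneq (b x) (b x0); first exact: (W x0 x1).
  have [e|nb1] := eqVneq (b x) (b x1).
    by apply: (W x1 x0) => //; rewrite eq_sym.
  by case: (G x0 x1 x); rewrite // eq_sym.
case: (boolP [forall z in A, (r z == r x1) || (b z == b x0)]).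
  by move/forall_inP=> h; apply: Or33; exists (r x1), (b x0).
move/forall_inPn=> [z zA]; rewrite negb_or => /andP[rz1 bz0].
case: (boolP [forall z in A, (b z == b x0) || (b z == b x1)]).
  by move/forall_inP=> h; apply: Or32; exists (b x0), (b x1).
move/forall_inPn=> [w wA]; rewrite negb_or => /andP[bw0 bw1].
exfalso.
(* Otherwise [z], [x1] and whichever of [x0], [x] is not in the row of [z] would be in general
   position. *)
have bz : b z = b x1.
  apply/eqP/negPn/negP => bz1.
  have [rz0|rz0] := eqVneq (r z) (r x0).
    by apply: (G x1 x z); rewrite // ?bx ?rz0 // eq_sym.
  by apply: (G x0 x1 z); rewrite // eq_sym.
(* Now [w] lies in a third column; whatever its row, it completes a triple in general position. *)
have [rw1|rw1] := eqVneq (r w) (r x1).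
  have [rz0|rz0] := eqVneq (r z) (r x0).
    by apply: (G w z x); rewrite // ?rw1 ?rz0 ?bz ?bx // eq_sym.
  by apply: (G w z x0); rewrite // ?rw1 ?bz // eq_sym.
have [rw0|rw0] := eqVneq (r w) (r x0).
  by apply: (G w x1 x); rewrite // ?rw0 ?bx // eq_sym.
by apply: (G w x0 x1); rewrite // eq_sym.
Qed.

Lemma no_parallel_cover (T : finType) (I J : eqType) (A B : {set T})
    (r : T -> I) (b : T -> J) :
  dense_crosses B A r b -> small_lines A B r -> small_lines A B b ->
  forall u v, ~ {in A, forall x, (r x == u) || (r x == v)}.
Proof.
move=> D Sr Sb u v covA.
have [y0 y0B] : exists2 y, y \in B & ~~ ((r y == u) || (r y == v)).
  apply: exists_not_covered => covB.
  by move: (leq_cnt_cover covA) (leq_cnt_cover covB) (Sr u) (Sr v); lia.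
rewrite negb_or => /andP[y0u y0v]; set j := b y0.
(* A cross centered off both rows can meet [A] only in its column. *)
have col0 y : y \in B -> r y != u -> r y != v ->
    2 * #|A| < 3 * cnt A (fun x => b x == b y).
  move=> yB yu yv; apply: leq_trans (D y yB) _; rewrite leq_mul2l.
  apply: leq_cnt => x xA /orP[/eqP e|//].
  by move: (covA x xA); rewrite e (negPf yu) (negPf yv).
have := col0 _ y0B y0u y0v; rewrite -/j => colj.
(* Otherwise column [j] holds all of [B] and over two thirds of [A]. *)
have [y1 y1B bj1] : exists2 y, y \in B & b y != j.
  apply: exists_not_covered => covB.
  have := @leq_cnt_cover _ B (fun y => b y == j) pred0.
  have -> : cnt B pred0 = 0 by rewrite cntE big1.
  move=> h; have /h : {in B, forall y, (b y == j) || pred0 y}.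
    by move=> y /covB ->.
  by have := Sb j; lia.
pose w := r y1.
have off y : y \in B -> b y != j ->
    3 * cnt A (predI (fun x => b x == j) (predC (fun x => r x == r y))) < #|A|.
  move=> yB yj; have := D y yB.
  have := @leq_cnt_disjoint _ A (same_line r b y)
    (predI (fun x => b x == j) (predC (fun x => r x == r y))).
  move=> h; have /h : {in A, forall x, same_line r b y x ->
    ~~ predI (fun x => b x == j) (predC (fun x => r x == r y)) x}.
    move=> x xA /orP[/eqP e|/eqP e] /=; first by rewrite e eqxx andbF.
    by rewrite e (negPf yj).
  by lia.
(* Column [j] has over two thirds of [A], and less than one third avoids the cross of [y1]; the rest
   lies in the cell of row [w] and column [j]. *)
have big : #|A| < 3 * cnt A (predI (fun x => b x == j) (fun x => r x == w)).
  have := off _ y1B bj1; rewrite -/w.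
  by have := cntID A (fun x => b x == j) (fun x => r x == w); lia.
(* The cross of any other [y] would miss this cell, which is too large to be missed. Row [w] and
   column [j] then have total size above [#|A| + #|B|], as the cell counts twice. *)
have covB : {in B, forall y, (r y == w) || (b y == j)}.
  move=> y yB; apply/negPn/negP; rewrite negb_or => /andP[yw yj].
  have := off _ yB yj; move: big.
  suff : cnt A (predI (fun x => b x == j) (fun x => r x == w)) <=
    cnt A (predI (fun x => b x == j) (predC (fun x => r x == r y))) by lia.
  by apply: leq_cnt => x xA /= /andP[-> /eqP ->]; rewrite eq_sym.
have := leq_cnt_cover covB.
have := cnt_predC A (fun x => b x == j).
have := cntID A (fun x => r x == w) (fun x => b x == j).
have -> : cnt A (predI (fun x => r x == w) (fun x => b x == j)) =
          cnt A (predI (fun x => b x == j) (fun x => r x == w)).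
  by rewrite !cntE; apply: eq_bigr => x _ /=; rewrite andbC.
by move: (Sr w) (Sb j); lia.
Qed.

(** A vertex of [A] off both columns lies in row [u], and its cross meets [B] only there. Applied to
    both sides, this makes a row shared by the two covers too large. *)
Lemma same_row_large (T : finType) (I J : eqType) (A B : {set T})
    (r : T -> I) (b : T -> J) u v1 v2 :
  dense_crosses A B r b ->
  {in A, forall x, (r x == u) || (b x == v1)} ->
  {in B, forall y, (r y == u) || (b y == v2)} ->
  ~ {in A, forall x, (b x == v1) || (b x == v2)} ->
  2 * #|B| < 3 * cnt B (fun y => r y == u).
Proof.
move=> D covA covB /exists_not_covered[x xA]; rewrite negb_or.
move=> /andP[x1 x2]; apply: leq_trans (D x xA) _; rewrite leq_mul2l.
have rx : r x = u by move: (covA x xA); rewrite (negPf x1) orbF => /eqP.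
apply: leq_cnt => y yB; rewrite /same_line rx => /orP[//|/eqP e].
by move: (covB y yB); rewrite e (negPf x2) orbF.
Qed.

Lemma not_all_lines_small (T : finType) (I J : eqType) (A B : {set T})
    (r : T -> I) (b : T -> J) :
  A != set0 -> B != set0 ->
  dense_crosses A B r b -> dense_crosses B A r b ->
  small_lines A B r -> small_lines A B b -> False.
Proof.
move=> A0 B0 DA DB Sr Sb.
have [DA' DB'] := (dense_crossesC DA, dense_crossesC DB).
have [Sr' Sb'] := (small_linesC Sr, small_linesC Sb).
have nAr := no_parallel_cover DB Sr Sb.
have nAb := no_parallel_cover DB' Sb Sr.
have nBr := no_parallel_cover DA Sr' Sb'.
have nBb := no_parallel_cover DA' Sb' Sr'.
case: (two_line_cover A0 (no_general_position DA)) => [] [u1 [v1 covA]].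
- exact: nAr covA.
- exact: nAb covA.
case: (two_line_cover B0 (no_general_position DB)) => [] [u2 [v2 covB]].
- exact: nBr covB.
- exact: nBb covB.
have [eu|neu] := eqVneq u1 u2.
  subst u2; have := same_row_large DA covA covB (nAb _ _).
  have := same_row_large DB covB covA (nBb _ _).
  by have := Sr u1; lia.
have covA' : {in A, forall x, (b x == v1) || (r x == u1)}.
  by move=> x /covA; rewrite orbC.
have covB' : {in B, forall x, (b x == v2) || (r x == u2)}.
  by move=> x /covB; rewrite orbC.
have [ev|nev] := eqVneq v1 v2.
  subst v2; have := same_row_large DA' covA' covB' (nAr _ _).
  have := same_row_large DB' covB' covA' (nBr _ _).
  by have := Sb v1; lia.
(* The covers share no line. Within [B], the cross of [x] meets only cells [(u1, v2)] and
   [(u2, b x)], that of [z] only [(r z, v2)] and [(u2, v1)]. These are disjoint, yet each cross has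
   over two thirds of [B]. *)
have [x xA] := exists_not_covered (nAb v1 v2).
rewrite negb_or => /andP[x1 x2].
have [z zA] := exists_not_covered (nAr u1 u2).
rewrite negb_or => /andP[z1 z2].
have rx : r x = u1 by move: (covA x xA); rewrite (negPf x1) orbF => /eqP.
have bz : b z = v1 by move: (covA z zA); rewrite (negPf z1) => /eqP.
move: (DA x xA) (DA z zA).
suff : cnt B (same_line r b x) + cnt B (same_line r b z) <= #|B| by lia.
apply: leq_cnt_disjoint => y yB; rewrite /same_line rx bz negb_or.
move: (covB y yB) => cy /orP[/eqP e|/eqP e]; move: cy; rewrite e.
  by rewrite (negPf neu) /= => /eqP ->; rewrite eq_sym z1 eq_sym.
by rewrite (negPf x2) orbF => /eqP ->; rewrite eq_sym z2.
Qed.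

End TwoLabelings.

(** * Monochromatic components as lines *)

Section MonochromaticComponents.
Set Implicit Arguments.
Unset Strict Implicit.
Local Open Scope nat_scope.

Lemma color_connect_sym (T : finType) (e : rel T) k (c : {set T} -> 'I_k) i :
  symmetric e -> connect_sym (color_rel e c i).
Proof.
by move=> es; apply: sym_connect_sym => x y; rewrite /color_rel /= es setUC.
Qed.

Lemma connect_color_support (T : finType) (e : rel T) k
    (c : {set T} -> 'I_k) i x y :
  connect (color_rel e c i) x y -> x != y -> x \in color_support e c i.
Proof.
move=> /connectP[[|z p] /= pth ->]; first by rewrite eqxx.
by move=> _; rewrite inE; apply/existsP; exists z; case/andP: pth.
Qed.

Lemma root_class_mono_component (T : finType) (e : rel T) k
    (c : {set T} -> 'I_k) i x :
  symmetric e -> x \in color_support e c i ->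
  [set y | fingraph.root (color_rel e c i) y ==
           fingraph.root (color_rel e c i) x]
    \in mono_components e c i.
Proof.
move=> es xS; apply/imsetP; exists x => //.
apply/setP=> y; rewrite in_set in_set.
rewrite root_connect; last exact: color_connect_sym.
rewrite [in RHS](color_connect_sym c i es).
case: (boolP (connect _ y x)) => [yx|_]; last by rewrite andbF.
rewrite andbT; have [->|nyx] := eqVneq y x; first by rewrite xS.
by rewrite (connect_color_support yx nyx).
Qed.

(** A fibre of [root] may be a single vertex isolated in color [i], which is no component; a second
    vertex in the fibre forces an edge of that color. *)
Lemma root_class_nontrivial (T : finType) (e : rel T) k
    (c : {set T} -> 'I_k) i t :
  symmetric e ->
  1 < #|[set y | fingraph.root (color_rel e c i) y == t]| ->
  [set y | fingraph.root (color_rel e c i) y == t] \in mono_components e c i.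
Proof.
move=> es /card_gt1P[x [y [xt yt nxy]]]; move: xt yt; rewrite !inE.
move=> /eqP xt /eqP yt; rewrite -xt; apply: root_class_mono_component => //.
apply: (connect_color_support (y := y)) => //.
by rewrite -root_connect ?xt ?yt //; exact: color_connect_sym.
Qed.

Lemma bigmin_leq (I : eqType) (s : seq I) (P : pred I) (F : I -> nat) k x :
  x \in s -> P x -> \big[minn/k]_(i <- s | P i) F i <= F x.
Proof.
move=> xs Px; elim: s xs => // a s IH; rewrite inE big_cons => /orP[/eqP <-|xs].
  by rewrite Px geq_minl.
by case: (P a); rewrite ?geq_min IH // orbT.
Qed.

Lemma min_degree_leq (T : finType) (e : rel T) (A B : {set T}) x :
  x \in A -> min_degree e A B <= degree_in e B x.
Proof. by move=> xA; apply: bigmin_leq => //; rewrite mem_index_enum. Qed.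

Lemma min_degree_card (T : finType) (e : rel T) (A B : {set T}) :
  min_degree e A B <= #|B|.
Proof.
rewrite /min_degree; apply: (big_ind (fun v => v <= #|B|)) => //.
  by move=> u v uB _; rewrite geq_min uB.
by move=> x _; apply/subset_leq_card/subsetP => y; rewrite inE => /andP[].
Qed.

Lemma min_degree_dense_crosses (T : finType) (e : rel T) (I J : eqType)
    (A B : {set T}) (r : T -> I) (b : T -> J) :
  (forall x y, e x y -> same_line r b x y) ->
  2 * #|B| < 3 * min_degree e A B -> dense_crosses A B r b.
Proof.
move=> eL dAB x xA; apply: leq_trans dAB _; rewrite leq_mul2l.
apply: leq_trans (min_degree_leq e B xA) _.
apply/subset_leq_card/subsetP => y; rewrite !inE => /andP[-> /eL //].
Qed.

Lemma cnt_bipartition (T : finType) (X Y : {set T}) (P : pred T) :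
  X :|: Y = [set: T] -> [disjoint X & Y] ->
  cnt X P + cnt Y P = #|[set x | P x]|.
Proof.
move=> XY dXY; rewrite /cnt -cardsUI.
have -> : [set x in X | P x] :&: [set x in Y | P x] = set0.
  apply/setP=> x; rewrite !inE; case xX: (x \in X) => //=.
  by rewrite (disjointFr dXY xX) andbF.
rewrite cards0 addn0; apply: eq_card => x; rewrite !inE -andb_orl.
by have := in_setT x; rewrite -XY inE => ->.
Qed.

Lemma large_mono_component (T : finType) (e : rel T) (X Y : {set T})
    (c : {set T} -> 'I_2) :
  simple_graph e -> bipartition e X Y ->
  2 * #|Y| < 3 * min_degree e X Y -> 2 * #|X| < 3 * min_degree e Y X ->
  exists i, exists2 C, C \in mono_components e c i & #|X| + #|Y| <= 2 * #|C|.
Proof.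
move=> [es _] [XY dXY _] dX dY.
case: (boolP [exists i, exists C in mono_components e c i,
                #|X| + #|Y| <= 2 * #|C|]) => [/existsP[i /exists_inP H]|nC].
  by exists i.
have small i C : C \in mono_components e c i -> 2 * #|C| < #|X| + #|Y|.
  move=> CM; rewrite ltnNge; apply: contra nC => H.
  by apply/existsP; exists i; apply/exists_inP; exists C.
(* Since [min_degree e Y X] is at most [#|X|], the strict degree bound fails for empty [X]. *)
have X0 : X != set0.
  by rewrite -card_gt0; have := min_degree_card e Y X; lia.
have Y0 : Y != set0.
  by rewrite -card_gt0; have := min_degree_card e X Y; lia.
(* Needed for singleton fibres, to which [small] may not apply. Some edge exists, and its component
   [C] gives [2 <= 2 * #|C| < #|X| + #|Y|]. *)
have XY2 : 2 < #|X| + #|Y|.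
  case/set0Pn: X0 => x xX; have := min_degree_leq e Y xX.
  case: (posnP (degree_in e Y x)) => [->|/card_gt0P[y]]; first by lia.
  rewrite inE => /andP[_ xy] _.
  have xS : x \in color_support e c (c [set x; y]).
    by rewrite inE; apply/existsP; exists y; rewrite /color_rel /= xy eqxx.
  apply: leq_trans (small _ _ (root_class_mono_component es xS)).
  by rewrite ltnS (leq_pmulr 2) //; apply/card_gt0P; exists x; rewrite inE.
pose f i := fingraph.root (color_rel e c i).
have S i : small_lines X Y (f i).
  move=> t; rewrite cnt_bipartition //.
  have [t1|t1] := leqP #|[set x | f i x == t]| 1; first by lia.
  by apply: (small i); apply: root_class_nontrivial.
(* An edge has one of the two colors, so its ends share the component of that color. *)
have eL x y : e x y -> same_line (f ord0) (f ord_max) x y.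
  move=> xy; rewrite /same_line !root_connect; try exact: color_connect_sym.
  rewrite !(color_connect_sym _ _ es y x).
  case: (c [set x; y] =P ord0) => [c0|c0].
    by rewrite connect1 // /color_rel /= xy c0.
  rewrite (_ : connect (color_rel e c ord_max) x y) ?orbT //.
  rewrite connect1 // /color_rel /= xy /=; case: (c _) c0 => [[|[|//]] H] c0;
    last exact/eqP/val_inj.
  by case: c0; apply: val_inj.
exfalso; apply: (not_all_lines_small X0 Y0 _ _ (S ord0) (S ord_max)).
  exact: min_degree_dense_crosses dX.
exact: min_degree_dense_crosses dY.
Qed.

End MonochromaticComponents.

(** * Transfer to rational bounds *)

Lemma two_thirds_lt (n d : nat) :
  (2 / 3 * n%:R : rat) < d%:R -> (2 * n < 3 * d)%N.
Proof. by move=> h; rewrite -(ltr_nat rat) !natrM; lra. Qed.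

Theorem theorem4 (T : finType) (e : rel T) (X Y : {set T}) (m n : nat)
    (he : simple_graph e) (hXY : bipartition e X Y)
    (hm : #|X| = m) (hn : #|Y| = n)
    (hdX : (2 / 3 * n%:R : rat) < (min_degree e X Y)%:R)
    (hdY : (2 / 3 * m%:R : rat) < (min_degree e Y X)%:R)
    (c : {set T} -> 'I_2) :
  exists i : 'I_2, exists2 C : {set T},
    C \in mono_components e c i & ((m + n)%:R / 2 : rat) <= #|C|%:R.
Proof.
subst m n.
have [i [C CM hC]] :=
  large_mono_component c he hXY (two_thirds_lt hdX) (two_thirds_lt hdY).
exists i, C => //; move: hC; rewrite -(ler_nat rat) natrM; lra.
Qed.
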